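(* Let $p$ be a prime with $p\equiv 3\pmod 4$ and set $n_0=\frac{p^2-1}{2}$. Then, modulo $p$: (i) $u\!\left(\frac{p-1}{2}\right)\equiv 0$; (ii) $u(n)\equiv 0$ for all $n\ge n_0$; (iii) $v(n)\equiv 0$ for all $n>n_0$.
   Context: Define integer sequences $u,v$ by $u(0)=v(0)=1$ and, for $n\ge 1$, $u(n)=\Big(\prod_{j=1}^{n}(4j-1)\Big)^2-\sum_{m=0}^{n-1}\binom{2n+1}{2m+1}\Big(\prod_{j=1}^{n-m}(4j-3)\Big)^2u(m)$, $v(n)=2^{n-1}\Big(\prod_{j=1}^{n}(4j-3)\Big)^2-\frac12\sum_{m=1}^{n-1}\binom{2n}{2m}v(m)v(n-m)$. *)

(* Defs.v *)
From HB Require Import structures.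
From mathcomp Require Import all_boot all_order all_algebra.
From mathcomp Require Import zify ring.
Set Implicit Arguments.
Unset Strict Implicit.
Unset Printing Implicit Defensive.
Import Order.TTheory GRing.Theory Num.Theory.
Local Open Scope ring_scope.

(* Course-of-values recursion with initial value 1: [cov_rec F] is the sequence
   w with w 0 = 1 and w n = F n w for n > 0, provided that F n only reads its
   second argument below n (lemma cov_recE). *)
Fixpoint cov_prefix (F : nat -> (nat -> int) -> int) (n : nat) : seq int :=
  if n is k.+1 then
    let s := cov_prefix F k in rcons s (F k.+1 (fun m => s`_m))
  else [:: 1].

Definition cov_rec (F : nat -> (nat -> int) -> int) (n : nat) : int :=
  (cov_prefix F n)`_n.

Definition u_step (n : nat) (w : nat -> int) : int :=
  (\prod_(1 <= j < n.+1) (4 * j%:Z - 1)) ^+ 2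
  - \sum_(0 <= m < n)
      'C(2 * n + 1, 2 * m + 1)%:Z
      * (\prod_(1 <= j < (n - m).+1) (4 * j%:Z - 3)) ^+ 2 * w m.

(* The Euclidean quotient by 2 is exact for the sequence v: lemma vE. *)
Definition v_step (n : nat) (w : nat -> int) : int :=
  2 ^+ (n - 1) * (\prod_(1 <= j < n.+1) (4 * j%:Z - 3)) ^+ 2
  - ((\sum_(1 <= m < n) 'C(2 * n, 2 * m)%:Z * w m * w (n - m)%N) %/ 2)%Z.

Definition u : nat -> int := cov_rec u_step.

Definition v : nat -> int := cov_rec v_step.

Lemma size_cov_prefix F n : size (cov_prefix F n) = n.+1.
Proof. by elim: n => //= n IHn; rewrite size_rcons IHn. Qed.

Lemma nth_cov_prefix F n m : (m <= n)%N -> (cov_prefix F n)`_m = cov_rec F m.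
Proof.
elim: n => [|n IHn]; first by case: m.
rewrite leq_eqVlt => /orP[/eqP -> //|lt_mn].
by rewrite /= nth_rcons size_cov_prefix lt_mn IHn.
Qed.

Lemma cov_recE F n :
    (forall w w' : nat -> int, (forall m, (m < n)%N -> w m = w' m) ->
       F n w = F n w') ->
  (0 < n)%N -> cov_rec F n = F n (cov_rec F).
Proof.
case: n => // n ext_F _.
rewrite {1}/cov_rec /= nth_rcons size_cov_prefix ltnn eqxx.
by apply: ext_F => m lt_mn; apply: nth_cov_prefix.
Qed.

Lemma u0 : u 0 = 1. Proof. by []. Qed.

Lemma v0 : v 0 = 1. Proof. by []. Qed.

Lemma uE n : (0 < n)%N ->
  u n = (\prod_(1 <= j < n.+1) (4 * j%:Z - 1)) ^+ 2
        - \sum_(0 <= m < n)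
            'C(2 * n + 1, 2 * m + 1)%:Z
            * (\prod_(1 <= j < (n - m).+1) (4 * j%:Z - 3)) ^+ 2 * u m.
Proof.
move=> n_gt0; rewrite /u cov_recE // => w w' eq_w; rewrite /u_step; congr (_ - _).
by rewrite !big_nat; apply: eq_bigr => m /andP[_ lt_mn]; rewrite eq_w.
Qed.

Lemma v_stepE n : (0 < n)%N -> v n = v_step n v.
Proof.
move=> n_gt0; rewrite /v cov_recE // => w w' eq_w.
rewrite /v_step; congr (_ - (_ %/ _)%Z).
rewrite !big_nat; apply: eq_bigr => m /andP[m_gt0 lt_mn].
by rewrite !eq_w // ltn_subrL m_gt0.
Qed.

Lemma even_sum_palindrome (L : nat) (f : nat -> int) :
    (forall i, (i < L)%N -> f i = f (L.-1 - i)%N) ->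
    (forall i, L = i.*2.+1 -> (2 %| f i)%Z) ->
  (2 %| \sum_(i < L) f i)%Z.
Proof.
have [n le_Ln] := ubnP L; elim: n L f le_Ln => // n IHn [|[|L]] f le_Ln sym mid.
- by rewrite big_ord0.
- by rewrite big_ord_recl big_ord0 addr0; apply: mid.
rewrite big_ord_recr big_ord_recl /= addrAC (sym 0%N) // subn0 /=.
have -> : f L.+1 + f L.+1 = f L.+1 * 2 by ring.
apply: rpredD; first exact: dvdz_mull.
apply: (IHn L (fun i => f i.+1)) => [|i lt_iL|i def_L]; first lia.
  by rewrite sym; [congr f; lia | lia].
by apply: mid; lia.
Qed.

Lemma even_v_sum n (w : nat -> int) :
  (2 %| \sum_(1 <= m < n) 'C(2 * n, 2 * m)%:Z * w m * w (n - m)%N)%Z.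
Proof.
rewrite -{1}(add0n 1%N) big_addn big_mkord.
apply: (@even_sum_palindrome _ (fun i =>
  'C(2 * n, 2 * (i + 1))%:Z * w (i + 1)%N * w (n - (i + 1))%N)) => [i lt_in|i n1E].
  have -> : ((n - 1).-1 - i + 1 = n - (i + 1))%N by lia.
  have -> : (n - (n - (i + 1)) = i + 1)%N by lia.
  rewrite -(@bin_sub _ (2 * (i + 1))%N); last lia.
  by rewrite mulnBr mulrAC.
have -> : n = i.+1.*2 by lia.
do 2![apply: dvdz_mulr]; rewrite addn1.
have -> : (2 * i.+1.*2 = (2 * i.+1).*2)%N by lia.
have -> : (2 * i.+1)%N = (2 * i).+2 by lia.
set k := (2 * i).+1.
have -> : 'C(k.+1.*2, k.+1) = (2 * 'C(k.*2.+1, k))%N.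
  have sym_k : 'C(k.*2.+1, k.+1) = 'C(k.*2.+1, k).
    by rewrite -(@bin_sub k.*2.+1 k); [congr ('C(_, _)); lia | lia].
  by rewrite doubleS binS sym_k mul2n addnn.
by rewrite PoszM; apply: dvdz_mulr.
Qed.

Lemma vE n : (0 < n)%N ->
  (v n)%:Q = 2 ^+ (n - 1) * (\prod_(1 <= j < n.+1) (4 * j%:Q - 3)) ^+ 2
             - 1 / 2 * \sum_(1 <= m < n)
                         'C(2 * n, 2 * m)%:Q * (v m)%:Q * (v (n - m)%N)%:Q.
Proof.
move=> n_gt0; rewrite v_stepE // /v_step rmorphB /=.
congr (_ - _).
  rewrite intrM !rmorphXn /= rmorph_prod; congr (_ * _ ^+ 2).
  by apply: eq_bigr => j _; rewrite /= intrB intrM.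
have /divzK/(congr1 (fun z : int => z%:Q)) := even_v_sum n v.
rewrite intrM rmorph_sum /= => sumE.
under [X in _ = _ * X]eq_bigr do rewrite -!intrM.
by rewrite -sumE; field.
Qed.

(* Main.v *)
(* With the exponential generating functions
     A = sum a(n) t^(2n)/(2n)!,     B = sum b(n) t^(2n+1)/(2n+1)!,
   where a(n) = (1 5 ... (4n-3))^2 and b(n) = (3 7 ... (4n-1))^2, the recursions
   say that U A = B and V(t)^2 = A(sqrt 2 t).  Since p = 3 mod 4, the factors
   3p of a and p of b make a(n) and b(n) vanish mod p beyond (3p-1)/4 and
   (p-3)/4.  Hence A and B reduce mod p into the span of the divided powers
   t^i/i! with i < p^2, which is closed under products because p divides
   C(i+j, i) whenever i, j < p^2 <= i+j; so U = B/A and V stay in that span.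
   For (i), every binomial coefficient in the recursion of u((p-1)/2) is some
   C(p, i) with 0 < i < p. *)
Require Import Defs.
From mathcomp Require Import all_boot all_order all_algebra.
From mathcomp Require Import zify.
Import GRing.Theory.
Local Open Scope ring_scope.

(** If [p] did not divide ['C(p ^ k, s)], the identity [s * 'C(p ^ k, s) = p ^ k * 'C(p ^ k - 1, s -
    1)] would force [p ^ k] to divide [s]. *)
Lemma prime_dvd_bin_expn (p k s : nat) :
  prime p -> (0 < s < p ^ k)%N -> (p %| 'C(p ^ k, s))%N.
Proof.
move=> p_pr /andP[]; case: s => // s _ lt_s.
apply: contraLR lt_s => ndvd; rewrite -leqNgt; apply: dvdn_leq => //.
rewrite -(@Gauss_dvdl _ _ 'C(p ^ k, s.+1)).
  by rewrite -mul_bin_diag dvdn_mulr.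
by rewrite coprimeXl // prime_coprime.
Qed.

Lemma prime_dvd_bin_carry (p k i j : nat) : prime p ->
  (i < p ^ k)%N -> (j < p ^ k)%N -> (p ^ k <= i + j)%N ->
  (p %| 'C(i + j, i))%N.
Proof.
move=> p_pr lt_i lt_j le_ij; rewrite -(subnKC le_ij) -binomial.Vandermonde.
apply: dvdn_sum => -[s /= lt_s] _.
(* The Vandermonde term at [s = 0] vanishes, as [j < p ^ k] gives [i + j - p ^ k < i]. *)
case: (posnP s) => [-> | s_gt0].
  by rewrite [X in (_ * X)%N]bin_small ?muln0 //; lia.
by apply/dvdn_mulr/prime_dvd_bin_expn => //; lia.
Qed.

Lemma dvdz_prod_nat (d : int) (m n i : nat) (F : nat -> int) :
  (m <= i < n)%N -> (d %| F i)%Z -> (d %| \prod_(m <= j < n) F j)%Z.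
Proof.
move=> i_in dvd_i; rewrite (bigD1_seq i) ?mem_index_iota ?iota_uniq //=.
exact: dvdz_mulr.
Qed.

Lemma dvdz_sum_nat (d : int) (m n : nat) (F : nat -> int) :
  (forall i, (m <= i < n)%N -> (d %| F i)%Z) ->
  (d %| \sum_(m <= i < n) F i)%Z.
Proof. by move=> dvdF; rewrite big_nat; apply: rpred_sum. Qed.

Lemma dvdz_prod_4j1 (p n : nat) : p = 3 %[mod 4] -> (p < 4 * n)%N ->
  (p%:Z %| \prod_(1 <= j < n.+1) (4 * j%:Z - 1))%Z.
Proof.
move=> p_mod4 lt_pn; apply: (@dvdz_prod_nat _ _ _ ((p + 1) %/ 4)%N); first lia.
by have -> : 4 * ((p + 1) %/ 4)%N%:Z - 1 = p%:Z by lia.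
Qed.

Lemma dvdz_prod_4j3 (p n : nat) : p = 3 %[mod 4] -> (3 * p < 4 * n)%N ->
  (p%:Z %| \prod_(1 <= j < n.+1) (4 * j%:Z - 3))%Z.
Proof.
move=> p_mod4 lt_pn.
apply: (@dvdz_prod_nat _ _ _ ((3 * p + 3) %/ 4)%N); first lia.
have -> : 4 * ((3 * p + 3) %/ 4)%N%:Z - 3 = 3 * p%:Z by lia.
exact: dvdz_mull.
Qed.

(** Doubling removes the quotient by 2; the factor 2 is cancelled later since [p] is odd. *)
Lemma double_vE n : (0 < n)%N ->
  2 * v n = 2 ^+ n * (\prod_(1 <= j < n.+1) (4 * j%:Z - 3)) ^+ 2
            - \sum_(1 <= m < n) 'C(2 * n, 2 * m)%:Z * v m * v (n - m)%N.
Proof.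
case: n => // n _; rewrite v_stepE // /v_step mulrBr subn1 /= (exprS 2 n) -mulrA.
by rewrite [X in _ - X]mulrC divzK ?even_v_sum.
Qed.

Lemma u_half_dvd (p : nat) : prime p -> p = 3 %[mod 4] ->
  (p%:Z %| u ((p - 1) %/ 2)%N)%Z.
Proof.
move=> p_pr p_mod4; have p_ge3 : (3 <= p)%N by lia.
rewrite uE; last lia.
apply: rpredB; first by apply/dvdz_mulr/dvdz_prod_4j1; lia.
apply: dvdz_sum_nat => m m_lt; do 2![apply: dvdz_mulr].
have -> : (2 * ((p - 1) %/ 2) + 1 = p)%N by lia.
by apply: prime_dvd_bin => //; lia.
Qed.

Lemma u_large_dvd (p n : nat) : prime p -> p = 3 %[mod 4] ->
  (p ^ 2 <= 2 * n + 1)%N -> (p%:Z %| u n)%Z.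
Proof.
move=> p_pr p_mod4; have p_ge3 : (3 <= p)%N by lia.
elim/ltn_ind: n => n IHn le_n.
have le_3p : (3 * p <= p ^ 2)%N by rewrite -mulnn leq_mul2r p_ge3 orbT.
rewrite uE; last lia.
apply: rpredB; first by apply/dvdz_mulr/dvdz_prod_4j1; lia.
apply: dvdz_sum_nat => m /andP[_ lt_mn].
(* If neither index is large, [2 * m + 1] and [2 * (n - m)] are below [p ^ 2] but their sum is not,
   so the binomial is divisible. *)
have [le_m | lt_m] := leqP (p ^ 2) (2 * m + 1); first exact/dvdz_mull/IHn.
have [le_nm | lt_nm] := leqP (p ^ 2) (2 * (n - m)).
  by apply/dvdz_mulr/dvdz_mull/dvdz_mulr/dvdz_prod_4j3; lia.
do 2![apply: dvdz_mulr].
have -> : (2 * n + 1 = 2 * m + 1 + 2 * (n - m))%N by lia.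
by apply: (@prime_dvd_bin_carry _ 2) => //; lia.
Qed.

Lemma v_large_dvd (p n : nat) : prime p -> p = 3 %[mod 4] ->
  (p ^ 2 <= 2 * n)%N -> (p%:Z %| v n)%Z.
Proof.
move=> p_pr p_mod4; have p_ge3 : (3 <= p)%N by lia.
elim/ltn_ind: n => n IHn le_n.
have le_3p : (3 * p <= p ^ 2)%N by rewrite -mulnn leq_mul2r p_ge3 orbT.
have p_coprime2 : coprimez p%:Z 2.
  by rewrite coprimezE /= prime_coprime // gtnNdvd.
rewrite -(Gauss_dvdzr _ p_coprime2) double_vE; last lia.
apply: rpredB; first by apply/dvdz_mull/dvdz_mulr/dvdz_prod_4j3; lia.
apply: dvdz_sum_nat => m /andP[m_gt0 lt_mn].
(* Here induction covers a large [n - m] too, since [0 < m] gives [n - m < n]. *)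
have [le_m | lt_m] := leqP (p ^ 2) (2 * m).
  exact/dvdz_mulr/dvdz_mull/IHn.
have [le_nm | lt_nm] := leqP (p ^ 2) (2 * (n - m)).
  by apply/dvdz_mull/IHn => //; lia.
do 2![apply: dvdz_mulr].
have -> : (2 * n = 2 * m + 2 * (n - m))%N by lia.
by apply: (@prime_dvd_bin_carry _ 2) => //; lia.
Qed.

Theorem theorem17 (p : nat) (p_prime : prime p) (p_mod4 : p = 3 %[mod 4]) :
  let n0 := ((p ^ 2 - 1) %/ 2)%N in
  [/\ (u ((p - 1) %/ 2)%N = 0 %[mod p%:Z])%Z,
      forall n : nat, (n0 <= n)%N -> (u n = 0 %[mod p%:Z])%Z
    & forall n : nat, (n0 < n)%N -> (v n = 0 %[mod p%:Z])%Z].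
Proof.
(* Oddness makes the division in [n0] exact: [2 * n0 + 1 = p ^ 2]. *)
have odd_p2 : odd (p ^ 2) by rewrite oddX; lia.
split=> [|n le_n|n lt_n]; rewrite mod0z; apply/dvdz_mod0P.
- exact: u_half_dvd.
- by apply: u_large_dvd => //; lia.
- by apply: v_large_dvd => //; lia.
Qed.
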